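(* Fix $K_1,K_2,\ldots,K_m\in\mathcal{K}_0^n$. Then for all $\lambda_1,\ldots,\lambda_m\ge0$, $$\left|\left(\lambda_1K_1+\lambda_2K_2+\cdots+\lambda_mK_m\right)^{\clubsuit}\right|=\sum_{i_1,i_2,\ldots,i_n=1}^{m}V^{\clubsuit}(K_{i_1},K_{i_2},\ldots,K_{i_n})\cdot\lambda_{i_1}\lambda_{i_2}\cdots\lambda_{i_n},$$ where the coefficients are given by $$V^{\clubsuit}(K_1,K_2,\ldots,K_n)=\left|B_2^n\right|\cdot\int_{S^{n-1}}h_{K_1}(\theta)h_{K_2}(\theta)\cdots h_{K_n}(\theta)\,\mathrm{d}\sigma(\theta).$$ Moreover, for every $K_1,K_2,\ldots,K_n\in\mathcal{K}_0^n$ we have $$V^{\clubsuit}(K_1,K_2,K_3,\ldots,K_n)^2\le V^{\clubsuit}(K_1,K_1,K_3,\ldots,K_n)\cdot V^{\clubsuit}(K_2,K_2,K_3,\ldots,K_n).$$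
   Context: A convex body in $\mathbb{R}^n$ is a closed convex set $K\subseteq\mathbb{R}^n$ with $0\in K$ (not assumed compact, nor with non-empty interior); $\mathcal{K}_0^n$ is the set of all convex bodies. The support function of $K$ is $h_K:S^{n-1}\to[0,\infty]$, $h_K(\theta)=\sup_{x\in K}\langle x,\theta\rangle$. Minkowski addition is $K+T=\overline{\{x+y:x\in K,\ y\in T\}}$ and $\lambda K=\{\lambda x:x\in K\}$. A star set is a non-empty $A\subseteq\mathbb{R}^n$ such that $x\in A$ and $0\le\lambda\le1$ imply $\lambda x\in A$; its radial function is $r_A(\theta)=\sup\{\lambda\ge0:\lambda\theta\in A\}\in[0,\infty]$. A star body is a star set $A$ with $r_A(\theta)\theta\in A$ for all $\theta\in S^{n-1}$ with $r_A(\theta)<\infty$; it is uniquely determined by $r_A$. For $K\in\mathcal{K}_0^n$, the flower $K^{\clubsuit}$ is the star body with radial function $r_{K^{\clubsuit}}=h_K$. $|\cdot|$ is volume (Lebesgue measure) on $\mathbb{R}^n$, $B_2^n$ is the unit Euclidean ball, and $\sigma$ is the uniform probability measure on $S^{n-1}$. Quantities take values in $[0,\infty]$, with the usual measure-theoretic convention $0\cdot\infty=0$. *)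

(* Defs.v *)
From HB Require Import structures.
From mathcomp Require Import all_boot all_order all_algebra.
From mathcomp Require Import all_classical all_reals all_analysis.
Import Order.TTheory GRing.Theory Num.Theory.
Import numFieldNormedType.Exports.

Set Implicit Arguments.
Unset Strict Implicit.
Unset Printing Implicit Defensive.

Local Open Scope classical_set_scope.
Local Open Scope ring_scope.

Section euclidean_space.
Context {R : realType} {n : nat}.
Implicit Types (x y : 'rV[R]_n) (A K T : set 'rV[R]_n).

(* The norm [`|x|] of the library on ['rV[R]_n] is the sup norm; it induces
   the usual topology, but the sphere and the ball below are Euclidean. *)
Definition dotp x y : R := \sum_(i < n) x 0 i * y 0 i.
Definition enorm x : R := Num.sqrt (dotp x x).
Definition unit_sphere : set 'rV[R]_n := [set x | enorm x = 1].
Definition unit_ball : set 'rV[R]_n := [set x | enorm x <= 1].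

Definition convex_body K : Prop :=
  [/\ closed K, convex_set (K : set (convex_lmodType 'rV[R]_n)) & K 0].

Definition support_fun K (theta : 'rV[R]_n) : \bar R :=
  ereal_sup [set (dotp x theta)%:E | x in K].

Definition minkowski_add K T : set 'rV[R]_n :=
  closure [set x + y | x in K & y in T].

Definition dilate (l : R) K : set 'rV[R]_n := [set l *: x | x in K].

Definition star_set A : Prop :=
  A !=set0 /\ forall x l, A x -> 0 <= l <= 1 -> A (l *: x).

Definition radial_fun A (theta : 'rV[R]_n) : \bar R :=
  ereal_sup [set l%:E | l in [set l : R | 0 <= l /\ A (l *: theta)]].

Definition star_body A : Prop :=
  star_set A /\
  forall theta, unit_sphere theta -> (radial_fun A theta < +oo)%E ->
    A (fine (radial_fun A theta) *: theta).

Definition is_flower K A : Prop :=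
  star_body A /\
  forall theta, unit_sphere theta -> radial_fun A theta = support_fun K theta.

(* [flowerP] and [flowerE] below show that for [0 < n] and a convex body [K]
   this choice is not a default value, and that the choice is unique. *)
Definition flower K : set 'rV[R]_n := get (is_flower K).

End euclidean_space.

(* Lebesgue measure of a Borel set of R^n: the n-fold product of the
   one-dimensional Lebesgue measure, with R^0 a point of mass 1. A vector of
   R^(p+1) is [row_mx x v] with [x] its first coordinate. *)
Fixpoint volume {R : realType} (n : nat) : set 'rV[R]_n -> \bar R :=
  match n return set 'rV[R]_n -> \bar R with
  | 0 => fun A => (\1_A (0 : 'rV[R]_0))%:E
  | p.+1 => fun A =>
      (\int[@lebesgue_measure R]_x
         volume [set v : 'rV[R]_p | A (row_mx (x%:M : 'rV[R]_1) v)])%E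
  end.

Definition borel_rV (R : realType) (n : nat) :=
  g_sigma_algebraType (@open 'rV[R]_n).


Section flower_mixed_volume.
Context {R : realType} {n : nat}.

Definition cone (A : set 'rV[R]_n) : set 'rV[R]_n :=
  [set t *: theta | t in [set t : R | 0 <= t <= 1]
                  & theta in A `&` unit_sphere].

(* Uniform probability measure on the sphere (normalized surface area), as a
   Borel measure on R^n carried by the sphere: the mass of [A] is the fraction
   of the unit ball lying over [A]. *)
Definition sphere_measure (A : set (borel_rV R n)) : \bar R :=
  (volume (cone A) / volume (@unit_ball R n))%E.

(* Products in [\bar R] satisfy [0 * +oo = 0]. *)
Definition flower_mixed_volume (K : 'I_n -> set 'rV[R]_n) : \bar R :=
  (volume (@unit_ball R n) *
   \int[sphere_measure]_(theta in (unit_sphere : set (borel_rV R n)))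
     \big[*%E/1%E]_(j < n) support_fun (K j) theta)%E.

(* Since dilates of convex bodies are closed, the trailing [+ {0}] of the
   iterated sum adds nothing. *)
Definition minkowski_comb (m : nat) (lam : 'I_m -> R)
    (K : 'I_m -> set 'rV[R]_n) : set 'rV[R]_n :=
  \big[@minkowski_add R n/[set 0]]_(i < m) dilate (lam i) (K i).

End flower_mixed_volume.

Section flower_theory.
Context {R : realType} {n : nat}.
Implicit Types (x y : 'rV[R]_n) (A K : set 'rV[R]_n).

Lemma dotpZ (a b : R) x y : dotp (a *: x) (b *: y) = a * b * dotp x y.
Proof.
by rewrite /dotp mulr_sumr; apply: eq_bigr => i _; rewrite !mxE mulrACA.
Qed.

Lemma dotp_ge0 x : 0 <= dotp x x.
Proof. by apply: sumr_ge0 => i _; rewrite -expr2 sqr_ge0. Qed.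

Lemma enormZ (l : R) x : enorm (l *: x) = `|l| * enorm x.
Proof. by rewrite /enorm dotpZ -expr2 sqrtrM ?sqr_ge0// sqrtr_sqr. Qed.

Lemma enorm_ge0 x : 0 <= enorm x.
Proof. exact: sqrtr_ge0. Qed.

Lemma enorm_eq0 x : enorm x = 0 -> x = 0.
Proof.
move=> /eqP; rewrite sqrtr_eq0 => x0.
have {x0}/eqP : dotp x x = 0 by apply/eqP; rewrite eq_le x0 dotp_ge0.
rewrite psumr_eq0 => [/allP x0|i _]; last by rewrite -expr2 sqr_ge0.
apply/rowP => i; have /= := x0 i (mem_index_enum _).
by rewrite mulf_eq0 orbb mxE => /eqP.
Qed.

Lemma unit_sphere_nonempty : (0 < n)%N -> exists x, @unit_sphere R n x.
Proof.
move=> n0; exists (delta_mx 0 (Ordinal n0)).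
rewrite /unit_sphere /enorm /dotp /= (bigD1 (Ordinal n0))//= big1.
  by rewrite !mxE !eqxx mulr1 addr0 sqrtr1.
by move=> i /negPf i0; rewrite !mxE i0 mulr0.
Qed.

Lemma support_fun_ge0 K theta : K 0 -> (0 <= support_fun K theta)%E.
Proof.
move=> K0; apply: ereal_sup_ubound; exists 0 => //.
by rewrite -[0]/(0%R) -(scale0r (0 : 'rV[R]_n)) -[theta]scale1r dotpZ !mul0r.
Qed.

Lemma star_body_radialP A theta (l : R) : star_body A -> unit_sphere theta ->
  0 <= l -> A (l *: theta) <-> (l%:E <= radial_fun A theta)%E.
Proof.
move=> [[_ sA] bA] th l0; split=> [Al|].
  by apply: ereal_sup_ubound; exists l.
rewrite le_eqVlt => /predU1P[lr|/ereal_sup_gt[_ [t [t0 At] <-]]].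
  by have := bA _ th; rewrite -lr ltry; exact.
rewrite lte_fin => lt; have t_gt0 : 0 < t by exact: le_lt_trans lt.
rewrite -(divfK (lt0r_neq0 t_gt0) l) -scalerA; apply: sA => //.
by rewrite divr_ge0//= ler_pdivrMr// mul1r ltW.
Qed.

Lemma polar_decomp x : (0 < n)%N ->
  exists2 theta, unit_sphere theta & x = enorm x *: theta.
Proof.
move=> n0; have [e0|x0] := eqVneq (enorm x) 0.
  have [th th1] := unit_sphere_nonempty n0; exists th => //.
  by rewrite e0 scale0r; exact: enorm_eq0.
exists ((enorm x)^-1 *: x); last by rewrite scalerA divff// scale1r.
by rewrite /unit_sphere /= enormZ ger0_norm ?invr_ge0 ?enorm_ge0// mulVf.
Qed.

Lemma star_body_inj A B : (0 < n)%N -> star_body A -> star_body B ->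
  (forall theta, unit_sphere theta -> radial_fun A theta = radial_fun B theta) ->
  A = B.
Proof.
move=> n0 sA sB AB; apply/seteqP; split=> x;
  have [th th1 ->] := polar_decomp x n0;
  move=> /star_body_radialP; move=> /(_ _ th1 (enorm_ge0 x)) H;
  apply/star_body_radialP => //; rewrite ?enorm_ge0//.
- by rewrite -AB//; exact: H.
- by rewrite AB//; exact: H.
Qed.

Definition flower_set K : set 'rV[R]_n :=
  [set x | exists theta, exists2 t : R, unit_sphere theta &
     [/\ 0 <= t, (t%:E <= support_fun K theta)%E & x = t *: theta]].

Lemma flower_setZ K theta (l : R) : K 0 -> unit_sphere theta -> 0 <= l ->
  flower_set K (l *: theta) <-> (l%:E <= support_fun K theta)%E.
Proof.
move=> K0 th1 l0; split=> [[th' [t th'1 [t0 tK E]]]|]; last first.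
  by exists theta; exists l.
have lt : l = t.
  have := congr1 (@enorm R n) E.
  by rewrite !enormZ !ger0_norm// th1 th'1 !mulr1.
have [->|l_neq0] := eqVneq l 0; first exact: support_fun_ge0.
suff -> : theta = th' by rewrite lt.
by move: E; rewrite -lt => /(scalerI l_neq0).
Qed.

Lemma flower_set_is_flower K : (0 < n)%N -> K 0 -> is_flower K (flower_set K).
Proof.
move=> n0 K0.
have rE theta : unit_sphere theta ->
    radial_fun (flower_set K) theta = support_fun K theta.
  move=> th1; apply/eqP; rewrite eq_le; apply/andP; split.
    apply: ge_ereal_sup => _ [l [l0 Kl] <-].
    by apply/flower_setZ.
  have := support_fun_ge0 theta K0.
  case Eh : (support_fun K theta) => [h| |]// h0.
    apply: ereal_sup_ubound; exists h => //; split; first by rewrite -lee_fin.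
    by apply/flower_setZ => //; rewrite ?Eh// -lee_fin.
  rewrite leye_eq; apply/eqP/eqyP => M M0.
  apply: ereal_sup_ubound; exists M => //; split; first exact: ltW.
  by apply/flower_setZ => //; rewrite ?Eh ?leey// ltW.
split; last exact: rE.
split; first split.
- have [th th1] := unit_sphere_nonempty n0.
  by exists (0 *: th); apply/flower_setZ => //; exact: support_fun_ge0.
- move=> _ l [th [t th1 [t0 tK ->]]] /andP[l0 l1]; rewrite scalerA.
  apply/flower_setZ => //; first exact: mulr_ge0.
  by apply: le_trans tK; rewrite lee_fin ler_piMl.
- move=> th th1; rewrite rE// => hK.
  have h0 := support_fun_ge0 th K0.
  have hf : support_fun K th \is a fin_num by rewrite ge0_fin_numE.
  by apply/flower_setZ => //; [exact: fine_ge0|rewrite fineK].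
Qed.

Lemma flowerE K : (0 < n)%N -> K 0 -> flower K = flower_set K.
Proof.
move=> n0 K0; apply: get_unique; first exact: flower_set_is_flower.
move=> A [sA rA]; have [sF rF] := flower_set_is_flower n0 K0.
by apply: star_body_inj => // th th1; rewrite rA// rF.
Qed.

Lemma flowerP K : (0 < n)%N -> K 0 -> is_flower K (flower K).
Proof. by move=> n0 K0; rewrite flowerE//; exact: flower_set_is_flower. Qed.

End flower_theory.

(* Main.v *)
Require Import Defs.
From HB Require Import structures.
From mathcomp Require Import all_boot all_order all_algebra.
From mathcomp Require Import all_classical all_reals all_analysis.
From mathcomp Require Import measurable_realfun.
From mathcomp Require Import ring lra.
Import Order.TTheory GRing.Theory Num.Theory.
Import numFieldNormedType.Exports.
Local Open Scope classical_set_scope.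
Local Open Scope ring_scope.

(** Everything rests on one change of variables, integration in polar
    coordinates. Write [nu] for the angular measure on the sphere: [nu A] is
    the volume of the part of the unit ball lying over [A], so that the uniform
    probability measure is [nu / |B|]. The scaling law |l X| = l^n |X| says that
    the image of Lebesgue measure on R^n minus the origin under
    x |-> (x/|x|, |x|^n) is the product of [nu] and of Lebesgue measure on
    ]0, +oo[ ([polar_measure_rect]). The flower of [K] is, up to the origin, the
    region |x|^n <= h_K(x/|x|)^n, whose slice over a direction [theta] has
    length h_K(theta)^n; Tonelli gives

      |flower K| = int_S h_K^n d nu                       ([volume_flower]),

    and the mixed volume, where the two factors |B| cancel, is

      V(K_1, .., K_n) = int_S h_{K_1} ... h_{K_n} d nu    ([flower_mixed_volumeE]).

    Both sides may be infinite; the integrands are Borel because a support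
    function is lower semicontinuous.

    The polynomial expansion follows: the support function is additive for
    Minkowski sums and positively homogeneous ([support_fun_comb]), so the
    integrand is (sum_i lambda_i h_{K_i})^n; expanding it is legitimate in
    [0, +oo] with 0 * oo = 0, a commutative semiring ([prode_sum_distr]). The
    inequality is Cauchy-Schwarz for the functions h_{K_1} and h_{K_2} with
    weight h_{K_3} ... h_{K_n} ([weighted_cauchy_schwarz]), proved for functions
    with values in [0, +oo].

    It remains to know that [volume], defined by iterated integration, is a
    measure on the Borel sets: inductively, it is the image of the product of
    Lebesgue measure and the volume one dimension lower ([volume_is_measure]).
    The map (x, v) |-> row_mx x v is measurable because Borel measurability in
    R^n can be tested on coordinates ([measurable_fun_rV]). *)

Set Implicit Arguments.
Unset Strict Implicit.
Unset Printing Implicit Defensive.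

Lemma measurable_preimage d d' (T1 : measurableType d) (T2 : measurableType d')
    (f : T1 -> T2) (A : set T2) :
  measurable_fun setT f -> measurable A -> measurable (f @^-1` A).
Proof. by move=> mf mA; rewrite -[X in measurable X]setTI; exact: mf. Qed.

(** * Borel measurability in coordinates *)

Section borel_rV.
Context {R : realType}.

Definition rat_box n (f : {ffun 'I_n -> rat * rat}) : set 'rV[R]_n :=
  [set x | forall i, x 0 i \in `]ratr (f i).1, ratr (f i).2[].

(** The index type is countable, so this exhibits the rational boxes as a
    countable basis. *)
Lemma open_rat_box n (U : set 'rV[R]_n) : open U ->
  U = \bigcup_(f in [set f | rat_box f `<=` U]) rat_box f.
Proof.
rewrite openE => oU; apply/seteqP; split => [x Ux|x [f fU /fU//]].
have [P xP PU] := oU x Ux.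
have /choice[f fP] : forall i, exists q : rat * rat,
    (x 0 i \in `]ratr q.1, ratr q.2[) /\
      [set` `]ratr q.1, ratr q.2[] `<=` P 0 i.
  move=> i; have /nbhs_ballP[e /= e0 eP] := xP 0 i.
  have /rat_in_itvoo[a] : x 0 i - e < x 0 i by rewrite ltrBlDr ltrDl.
  have /rat_in_itvoo[b] : x 0 i < x 0 i + e by rewrite ltrDl.
  rewrite !in_itv/= => /andP[xb be] /andP[ea ax].
  exists (a, b); split; first by rewrite in_itv/= ax xb.
  move=> y; rewrite /= in_itv/= => /andP[ay yb]; apply: eP.
  rewrite /ball/= ltr_distlC (lt_trans ea ay)/=.
  exact: lt_trans yb be.
exists (finfun f); last by move=> i; rewrite ffunE; have [] := fP i.
move=> y fy; apply: PU => j i; rewrite (ord1 j).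
by have [_] := fP i; apply; have := fy i; rewrite ffunE.
Qed.

Lemma measurable_coord n (i : 'I_n) :
  measurable_fun setT (fun x : borel_rV R n => (x : 'rV[R]_n) 0 i).
Proof.
apply: (measurability _ (RGenOInfty.measurableE R)).
move=> _ [_ [a ->] <-]; rewrite setTI; apply: sub_sigma_algebra.
apply: open_comp; last exact: rray_open.
by move=> x _; exact: coord_continuous.
Qed.

(** The Borel sigma-algebra of R^n is generated by rational boxes, whose
    preimages are finite intersections of preimages of intervals. *)
Lemma measurable_fun_rV d (T : measurableType d) n (f : T -> borel_rV R n) :
  (forall i, measurable_fun setT (fun t => (f t : 'rV[R]_n) 0 i)) ->
  measurable_fun setT f.
Proof.
move=> mf.
apply: (@measurability _ _ _ (borel_rV R n) _ _ (@open 'rV[R]_n)) => //.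
move=> _ [U oU <-]; rewrite setTI (open_rat_box oU) preimage_bigcup.
rewrite bigcup_mkcond.
apply: countable_bigcupT_measurable => [|g]; first exact: countableP.
case: ifPn => // _.
have -> : f @^-1` rat_box g = \bigcap_(i in [set: 'I_n])
    (fun t => (f t : 'rV[R]_n) 0 i) @^-1`
      `]ratr (g i).1, ratr (g i).2[%classic.
  by apply/seteqP; split => t /= H i; [move=> _|]; exact: H.
apply: fin_bigcap_measurable => // i _.
exact: measurable_preimage.
Qed.

Lemma measurable_scale n (l : R) : measurable_fun setT
  (fun x : borel_rV R n => l *: (x : 'rV[R]_n) : borel_rV R n).
Proof.
apply: measurable_fun_rV => i; under eq_fun do rewrite mxE.
exact: (measurableT_comp (mulrl_measurable _)) (measurable_coord i).
Qed.

Lemma measurable_row_mx n :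
  measurable_fun setT (fun q : R * borel_rV R n =>
    row_mx (q.1%:M : 'rV[R]_1) q.2 : borel_rV R n.+1).
Proof.
apply: measurable_fun_rV => i /=.
rewrite (_ : (fun _ => _) = fun q : R * borel_rV R n =>
    match fintype.split (i : 'I_(1 + n)) with
    | inl _ => q.1 | inr j => q.2 0 j
    end).
  case: fintype.split => j /=; first exact: measurable_fst.
  exact: (measurableT_comp (measurable_coord j)) measurable_snd.
apply/funext => q; rewrite mxE; case: fintype.split => j //.
by rewrite mxE (ord1 j) eqxx mulr1n.
Qed.

Lemma measurable_enorm n :
  measurable_fun setT (@enorm R n : borel_rV R n -> R).
Proof.
apply: (measurableT_comp (continuous_measurable_fun (@sqrt_continuous R))).
by apply: measurable_sum => i; apply: measurable_funM; exact: measurable_coord.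
Qed.

Lemma measurable_unit_ball n :
  measurable (@unit_ball R n : set (borel_rV R n)).
Proof.
rewrite (_ : unit_ball = @enorm R n @^-1` `]-oo, 1]%classic)//.
exact: measurable_preimage (@measurable_enorm n) _.
Qed.

Lemma measurable_unit_sphere n :
  measurable (@unit_sphere R n : set (borel_rV R n)).
Proof.
rewrite (_ : unit_sphere = @enorm R n @^-1` [set 1])//.
exact: measurable_preimage (@measurable_enorm n) _.
Qed.

Lemma dotp_continuous n (x : 'rV[R]_n) : continuous (dotp x : 'rV[R]_n -> R).
Proof.
apply: (@continuous_big _ _ +%R 0 xpredT) => [|i _ y].
  exact: add_continuous.
by apply: continuousM; [exact: cst_continuous|exact: coord_continuous].
Qed.

(** A supremum of continuous functions is lower semicontinuous. *)
Lemma measurable_support_fun n (K : set 'rV[R]_n) :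
  measurable_fun setT (support_fun K : borel_rV R n -> \bar R).
Proof.
apply: (measurability _ (ErealGenOInfty.measurableE R)).
move=> _ [_ [a ->] <-]; rewrite setTI; apply: sub_sigma_algebra.
rewrite preimage_itvoy.
rewrite (_ : [set _ | _] = \bigcup_(x in K) [set theta | a < dotp x theta]).
  apply: bigcup_open => x _.
  rewrite (_ : [set _ | _] = dotp x @^-1` `]a, +oo[%classic); last first.
    by apply/seteqP; split => t /=; rewrite in_itv/= andbT.
  apply: open_comp; last exact: rray_open.
  by move=> y _; exact: dotp_continuous.
apply/seteqP; split => theta /=.
  by move=> /ereal_sup_gt[_ [x Kx <-]]; rewrite lte_fin => ax; exists x.
move=> [x Kx /= ax].
apply: (@lt_le_trans _ _ (dotp x theta)%:E); first by rewrite lte_fin.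
by apply: ereal_sup_ubound; exists x.
Qed.

End borel_rV.

(** * Measures and integrals *)

(** The pushforward, bundled with the measurability proof from which its
    measure structure is built. *)
Definition image_measure d d' (T1 : measurableType d) (T2 : measurableType d')
    (R : realType) (m : {measure set T1 -> \bar R}) (f : T1 -> T2)
    (mf : measurable_fun setT f) : {measure set T2 -> \bar R}.
Proof. by refine (pushforward m f : {measure set T2 -> \bar R}). Defined.

Section sigma_finite_measure_of.
Context d (T : measurableType d) (R : realType).
Variable m : {measure set T -> \bar R}.

(** A fresh name for [m], so that attaching a sigma-finite structure to it does
    not affect the structures of [m] itself. *)
Definition measure_copy (A : set T) : \bar R := m A.

HB.instance Definition _ := isMeasure.Build _ T R measure_copy
  (measure0 m) (fun A => measure_ge0 m A)
  (@measure_semi_sigma_additive _ _ _ m).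

Hypothesis sm : sigma_finite setT measure_copy.

HB.instance Definition _ := Measure_isSigmaFinite.Build _ _ _ measure_copy sm.

Definition sigma_finite_measure_of : {sigma_finite_measure set T -> \bar R}.
Proof. by refine (measure_copy : {sigma_finite_measure set T -> \bar R}). Defined.

End sigma_finite_measure_of.

Section measure_complements.
Context {R : realType}.

Import HBNNSimple.

(** Integrals only see the measure of measurable sets, so [m] itself need not
    carry a measure structure. *)
Lemma integral_agree d (T : measurableType d) (m : set T -> \bar R)
    (m' : {measure set T -> \bar R}) (D : set T) (f : T -> \bar R) :
  (forall A, measurable A -> m A = m' A) ->
  (\int[m]_(x in D) f x = \int[m']_(x in D) f x)%E.
Proof.
move=> mm'.
have sE (h : {nnsfun T >-> R}) : sintegral m h = sintegral m' h.
  by apply: eq_fsbigr => r _; rewrite mm'.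
rewrite /integral; congr (ereal_sup _ - ereal_sup _)%E;
  by apply/seteqP; split => _ [h hf <-]; exists h => //; rewrite sE.
Qed.

Lemma emeasurable_prod d (T : measurableType d) (I : Type) (s : seq I)
    (h : I -> T -> \bar R) :
  (forall i, measurable_fun setT (h i)) ->
  measurable_fun setT (fun x => \big[*%E/1%E]_(i <- s) h i x).
Proof.
move=> mh; elim: s => [|i s IHs].
  by rewrite (_ : (fun x => _) = cst 1%E)//; apply/funext => x; rewrite big_nil.
rewrite (_ : (fun x => _) =
    (fun x => h i x * \big[*%E/1%E]_(j <- s) h j x)%E).
  exact: emeasurable_funM.
by apply/funext => x; rewrite big_cons.
Qed.

Lemma prode_const n (x : \bar R) : (\big[*%E/1%E]_(j < n) x = x ^+ n)%E.
Proof.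
elim: n => [|n IHn]; rewrite ?big_ord0 ?expe0//.
by rewrite big_ord_recl IHn expeS.
Qed.

Lemma measurable_fun_expe d (T : measurableType d) (f : T -> \bar R) n :
  measurable_fun setT f -> measurable_fun setT (fun x => f x ^+ n)%E.
Proof.
move=> mf; rewrite (_ : (fun x => _) = fun x => \big[*%E/1%E]_(j < n) f x)%E.
  exact: emeasurable_prod.
by apply/funext => x; rewrite prode_const.
Qed.

(** Half-open intervals form a generating pi-system, and each is the difference
    of two rays of finite measure. *)
Lemma measure_eq_rays (m1 m2 : {measure set (measurableTypeR R) -> \bar R}) :
  (forall b, m1 `]-oo, b]%classic = m2 `]-oo, b]%classic) ->
  (forall b, m1 `]-oo, b]%classic < +oo)%E ->
  forall A, measurable A -> m1 A = m2 A.
Proof.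
move=> m12 m1oo.
have mray b : measurable (`]-oo, b]%classic : set (measurableTypeR R)).
  exact: measurable_itv.
have ray_diff (a b : R) :
    `]a, b]%classic = `]-oo, b]%classic `\` `]-oo, a]%classic.
  apply/seteqP; split => x /=; rewrite !in_itv/=.
    by move=> /andP[ax xb]; split => //; apply/negP; rewrite -ltNge.
  by move=> [xb /negP]; rewrite -ltNge => ->.
apply: (@measure_unique _ R (measurableTypeR R) (@ocitv R)
  (fun k => `](- k%:R), k%:R]%classic)) => //.
- exact: ocitvI.
- by move=> k; exact: is_ocitv.
- apply/seteqP; split => // x _; exists (Num.truncn `|x|).+1 => //=.
  have := truncnS_gt `|x|; rewrite ltr_norml => /andP[xk kx].
  by rewrite in_itv/= xk ltW.
- move=> _ [[a b]] _ <- /=; have [ab|ba] := leP a b; last first.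
    by rewrite set_itv_ge ?measure0//= bnd_simp -leNgt ltW.
  have m2oo c : (m2 `]-oo, c]%classic < +oo)%E by rewrite -m12.
  rewrite ray_diff !measureD//; [|exact: m2oo|exact: m1oo].
  rewrite setIidr; last first.
    by move=> x /=; rewrite !in_itv/= => xa; exact: le_trans ab.
  by congr (_ - _)%E; exact: m12.
- move=> k; apply: le_lt_trans (m1oo k%:R).
  by rewrite ray_diff; apply: le_measure; rewrite ?inE//; exact: measurableD.
Qed.

Lemma lebesgue_measure_scale (l : R) (A : set R) : 0 < l -> measurable A ->
  lebesgue_measure A = (l%:E * lebesgue_measure ( *%R l @^-1` A))%E.
Proof.
move=> l0.
have ml : measurable_fun setT ( *%R l : measurableTypeR R -> measurableTypeR R).
  exact: mulrl_measurable.
pose m : {measure set (measurableTypeR R) -> \bar R} :=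
  mscale (NngNum (ltW l0)) (image_measure (@lebesgue_measure R) ml).
apply: (@lebesgue_measure_unique R m) => _ [[a b]] _ <-.
transitivity
    (l%:E * lebesgue_measure (`](a / l)%R, (b / l)%R]%classic : set R))%E; last first.
  congr (_ * lebesgue_measure _)%E; apply/seteqP.
  by split => x; rewrite /= !in_itv/= ltr_pdivrMr// ler_pdivlMr// ![x * _]mulrC.
rewrite !lebesgue_measure_itv/= !lte_fin ltr_pM2r ?invr_gt0//.
case: ifPn => ab; last by rewrite mule0.
by rewrite -!EFinB -EFinM mulrBr !(mulrC l) !divfK// gt_eqF.
Qed.

Lemma ge0_integral_scale (l : R) (f : R -> \bar R) : 0 < l ->
  measurable_fun setT f -> (forall x, 0 <= f x)%E ->
  (\int[lebesgue_measure]_x f x =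
   l%:E * \int[lebesgue_measure]_x f (l * x)%R)%E.
Proof.
move=> l0 mf f0.
have ml : measurable_fun setT ( *%R l : measurableTypeR R -> measurableTypeR R).
  exact: mulrl_measurable.
pose m := image_measure (@lebesgue_measure R) ml.
transitivity (l%:E * \int[m]_x f x)%E; last first.
  by congr (_ * _)%E; rewrite /m [LHS](ge0_integral_pushforward ml).
rewrite -(@ge0_integral_mscale _ _ _ m setT measurableT (NngNum (ltW l0)))//.
by apply: eq_measure_integral => A mA _; exact: lebesgue_measure_scale.
Qed.

End measure_complements.

(** * Volume as a Borel measure *)

Section volume.
Context {R : realType}.

Lemma volumeS n (A : set 'rV[R]_n.+1) :
  volume A =
  (@lebesgue_measure R \x (@volume R n : set (borel_rV R n) -> \bar R))%E
    ((fun q : R * borel_rV R n => row_mx (q.1%:M : 'rV[R]_1) q.2) @^-1` A).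
Proof.
rewrite /product_measure1 /=; apply: eq_integral => x _ /=.
by congr (volume _); apply/seteqP; split => v; rewrite /xsection/= inE.
Qed.

Definition box n (a : R) : set 'rV[R]_n := [set x | forall i, `|x 0 i| <= a].

Arguments box : clear implicits.

Lemma measurable_box n a : measurable (box n a : set (borel_rV R n)).
Proof.
rewrite [box n a](_ : _ = \bigcap_(i in [set: 'I_n])
    (fun x : borel_rV R n => (x : 'rV[R]_n) 0 i) @^-1` `[-a, a]%classic).
  apply: fin_bigcap_measurable => // i _.
  exact: measurable_preimage (@measurable_coord R n i) _.
apply/seteqP; split => x /= bx i; have := bx i.
  by rewrite /= in_itv/= ler_norml.
by rewrite /= in_itv/= ler_norml; exact.
Qed.

Lemma bigcup_box n : \bigcup_k box n k%:R = setT.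
Proof.
apply/seteqP; split => // x _.
exists (Num.truncn (\sum_i `|x 0 i|)).+1 => // i.
apply/ltW/(le_lt_trans _ (truncnS_gt _)).
by rewrite (bigD1 i)//= lerDl sumr_ge0.
Qed.

Lemma volume_set0 n : volume (set0 : set 'rV[R]_n) = 0%E.
Proof.
elim: n => [|n IHn] /=; first by rewrite indic0.
by apply: integral0_eq => x _; exact: IHn.
Qed.

Lemma volume_box n a : 0 <= a -> volume (box n a) = ((2 * a) ^+ n)%:E.
Proof.
move=> a0; elim: n => [|n IHn].
  by rewrite /= indicE mem_set// => -[].
transitivity (\int[@lebesgue_measure R]_x
    (((2 * a) ^+ n)%:E * (\1_(`[-a, a]%classic : set R) x)%:E)%E)%E.
  apply: eq_integral => x _ /=; rewrite -IHn indicE.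
  have [|] := boolP (x \in _);
      rewrite (inE, notin_setE)/= in_itv/= -ler_norml => xa.
    rewrite mule1; congr volume; apply/seteqP; split => v /= bv i.
      by have := bv (rshift 1 i); rewrite (row_mxEr (x%:M : 'rV_1)).
    rewrite -[i](@splitK 1 n); case: fintype.split => j /=.
      by rewrite (row_mxEl (x%:M : 'rV_1)) (ord1 j) mxE eqxx mulr1n.
    by rewrite (row_mxEr (x%:M : 'rV_1)).
  rewrite mule0 -(volume_set0 n); congr volume; apply/seteqP; split => v //= bv.
  apply: xa; have := bv (lshift n (0 : 'I_1)).
  by rewrite (row_mxEl (x%:M : 'rV_1)) mxE eqxx mulr1n.
rewrite ge0_integralZl_EFin//; last 2 first.
- exact/measurable_EFinP/measurable_indic.
- by rewrite exprn_ge0// mulr_ge0.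
rewrite integral_indic//= setIT lebesgue_measure_itv/= lte_fin.
case: ltP => aa; last first.
  have -> : a = 0 by lra.
  by rewrite mulr0 mule0 expr0n.
by rewrite -EFinB -EFinM exprSr; congr (_ * _)%:E; lra.
Qed.

(** Sigma-finiteness is part of the induction: it makes the volume of slices a
    measurable function, hence the product with Lebesgue measure a measure. *)
Lemma volume_is_measure n :
  exists m : {sigma_finite_measure set (borel_rV R n) -> \bar R},
    (m : set (borel_rV R n) -> \bar R) = @volume R n.
Proof.
elim: n => [|n [m mE]].
  by exists (@dirac _ (borel_rV R 0) (0 : 'rV[R]_0) R).
pose m' := image_measure (@lebesgue_measure R \x m)%E (@measurable_row_mx R n).
have m'E A : m' A = volume A by rewrite volumeS -mE.
have sm' : sigma_finite setT m'.
  exists (fun k => box n.+1 k%:R); first by rewrite bigcup_box.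
  move=> k; split; first exact: measurable_box.
  by rewrite m'E volume_box// ltry.
exists (@sigma_finite_measure_of _ _ _ m' sm').
by apply/funext => A; exact: m'E.
Qed.

Definition borel_volume n (A : set (borel_rV R n)) : \bar R := volume A.

Let volume0 n : @borel_volume n set0 = 0%E.
Proof. exact: volume_set0. Qed.

Let volume_ge0 n A : (0 <= @borel_volume n A)%E.
Proof.
rewrite /borel_volume; elim: n A => [|n IHn] A /=; first by rewrite lee_fin.
by apply: integral_ge0 => x _; exact: IHn.
Qed.

Let volume_semi_sigma_additive n : semi_sigma_additive (@borel_volume n).
Proof.
have [m mE] := volume_is_measure n; rewrite (_ : borel_volume (n:=n) = m)//.
exact: measure_semi_sigma_additive.
Qed.

HB.instance Definition _ n := isMeasure.Build _ (borel_rV R n) R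
  (@borel_volume n) (volume0 n) (@volume_ge0 n)
  (@volume_semi_sigma_additive n).

Lemma measurable_volume_section n (A : set (borel_rV R n.+1)) : measurable A ->
  measurable_fun setT (fun x : R =>
    volume [set v : 'rV[R]_n | A (row_mx (x%:M : 'rV[R]_1) v)]).
Proof.
move=> mA; have [m mE] := volume_is_measure n.
have := measurable_fun_xsection m
  (measurable_preimage (@measurable_row_mx R n) mA).
apply: eq_measurable_fun => x _ /=; rewrite mE; congr volume.
by apply/seteqP; split => v; rewrite /xsection/= inE.
Qed.

(** Induction on the dimension: the slices are scaled by [l] in dimension [n],
    and the remaining factor [l] comes from the first coordinate. *)
Lemma volume_scale n (l : R) (A : set (borel_rV R n)) : 0 < l -> measurable A ->
  volume A = ((l ^+ n)%:E * volume ((fun x : 'rV[R]_n => l *: x) @^-1` A))%E.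
Proof.
move=> l0; elim: n A => [|n IHn] A mA.
  by rewrite expr0 mul1e /=; congr (\1_ _ _)%:E; rewrite scaler0.
have mlA := measurable_preimage (@measurable_scale R n.+1 l) mA.
rewrite [LHS](ge0_integral_scale l0 (measurable_volume_section mA)); last first.
  by move=> x; exact: (@volume_ge0 n).
rewrite exprS EFinM -muleA; congr (_ * _)%E.
have sect0 x : setT x -> (0 <= volume [set v : 'rV[R]_n |
    ((fun x : 'rV[R]_n.+1 => l *: x) @^-1` A) (row_mx (x%:M : 'rV[R]_1) v)])%E.
  by move=> _; exact: (@volume_ge0 n).
have ln0 : 0 <= l ^+ n by rewrite exprn_ge0 ?ltW.
apply: (eq_trans _ (ge0_integralZl_EFin (@lebesgue_measure R) measurableT sect0
  (measurable_volume_section mlA) ln0)).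
apply: eq_integral => x _; rewrite IHn.
  congr (_ * volume _)%E; apply/seteqP; split => v /=;
  by rewrite (@scale_row_mx _ 1 1 n) scale_scalar_mx.
apply: (measurable_preimage (pair1_measurable (l * x : R))
  (measurable_preimage (@measurable_row_mx R n) mA)).
Qed.

End volume.
Arguments box {R} n a _.

(** * Polar coordinates *)

Section polar.
Context {R : realType} {n : nat}.
Local Notation rV := 'rV[R]_n.
Local Notation mu := (@borel_volume R n).

(** The direction x/|x|; at the origin the conventions for inverses give 0. *)
Definition dirn (x : rV) : rV := (enorm x)^-1 *: x.

Definition punctured : set rV := [set x | 0 < enorm x].
Definition punctured_ball : set rV := [set x | 0 < enorm x <= 1].

Lemma measurable_dirn :
  measurable_fun setT (dirn : borel_rV R n -> borel_rV R n).
Proof.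
apply: measurable_fun_rV => i.
apply: (@eq_measurable_fun _ _ _ _ _
  (fun x : borel_rV R n => (enorm x `^ (-1)) * (x : rV) 0 i)).
  by move=> x _; rewrite /dirn mxE powR_inv1// enorm_ge0.
apply: measurable_funM; last exact: measurable_coord.
exact: (measurableT_comp (measurable_powR (-1)) (@measurable_enorm R n)).
Qed.

Lemma measurable_punctured : measurable (punctured : set (borel_rV R n)).
Proof.
rewrite (_ : punctured = @enorm R n @^-1` `]0, +oo[%classic); last first.
  by apply/seteqP; split => x /=; rewrite in_itv/= andbT.
exact: measurable_preimage (@measurable_enorm R n) _.
Qed.

Lemma measurable_punctured_ball :
  measurable (punctured_ball : set (borel_rV R n)).
Proof.
rewrite (_ : punctured_ball = @enorm R n @^-1` `]0, 1]%classic)//.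
exact: measurable_preimage (@measurable_enorm R n) _.
Qed.

Lemma enorm0 : @enorm R n 0 = 0.
Proof. by rewrite -(scale0r (0 : rV)) enormZ normr0 mul0r. Qed.

Lemma punctured_eq0 (x : rV) : ~ punctured x -> x = 0.
Proof.
move=> /negP; rewrite -leNgt => x0; apply: enorm_eq0.
by apply/eqP; rewrite eq_le x0 enorm_ge0.
Qed.

Lemma dirn_sphere x : punctured x -> unit_sphere (dirn x).
Proof.
move=> x0; rewrite /unit_sphere /dirn /= enormZ gtr0_norm ?invr_gt0//.
by rewrite mulVf// gt_eqF.
Qed.

Lemma dirnZ (l : R) x : 0 < l -> dirn (l *: x) = dirn x.
Proof.
move=> l0; rewrite /dirn enormZ gtr0_norm// scalerA invfM mulrAC.
by rewrite mulVf ?gt_eqF// mul1r.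
Qed.

Lemma dirnK x : punctured x -> enorm x *: dirn x = x.
Proof. by move=> x0; rewrite /dirn scalerA divff ?gt_eqF// scale1r. Qed.

Lemma unit_ball_box : @unit_ball R n `<=` box n 1.
Proof.
move=> x x1 i.
rewrite -(@ler_pXn2r _ 2)// ?nnegrE// expr1n real_normK ?num_real//.
have : enorm x ^+ 2 <= 1 by rewrite expr_le1// enorm_ge0.
rewrite sqr_sqrtr ?dotp_ge0//; apply: le_trans.
rewrite /dotp (bigD1 i)//= expr2 lerDl sumr_ge0// => j _.
by rewrite -expr2 sqr_ge0.
Qed.

Lemma volume_unit_ball_lty : (mu unit_ball < +oo)%E.
Proof.
apply: (@le_lt_trans _ _ (mu (box n 1))); last first.
  by rewrite /borel_volume volume_box// ltry.
apply: le_measure; rewrite ?inE//;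
  [exact: measurable_unit_ball|exact: measurable_box|].
exact: unit_ball_box.
Qed.

Lemma volume_unit_ball_gt0 : (0 < mu unit_ball)%E.
Proof.
(* half-side 1/(n+1): the n coordinates contribute at most n/(n+1)^2 to |x|^2 *)
apply: (@lt_le_trans _ _ (mu (box n n.+1%:R^-1))).
  by rewrite /borel_volume volume_box// lte_fin exprn_gt0// mulr_gt0.
apply: le_measure; rewrite ?inE//;
  [exact: measurable_box|exact: measurable_unit_ball|].
move=> x bx; rewrite /unit_ball /enorm /= -[leRHS]sqrtr1 ler_wsqrtr//.
apply: (@le_trans _ _ (\sum_(i < n) n.+1%:R^-1)).
  apply: ler_sum => i _; rewrite -expr2 -real_normK ?num_real// expr2.
  apply: (@le_trans _ _ (n.+1%:R^-1 * 1)); last by rewrite mulr1.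
  apply: ler_pM => //.
  by apply: (le_trans (bx i)); rewrite invf_le1// ler1n.
by rewrite sumr_const card_ord -[leLHS]mulr_natl ler_pdivrMr// mul1r ler_nat.
Qed.

Definition angular_measure : {measure set (borel_rV R n) -> \bar R} :=
  image_measure (mrestr mu measurable_punctured_ball) measurable_dirn.

Lemma angular_measureE A :
  angular_measure A = mu (dirn @^-1` A `&` punctured_ball).
Proof. by []. Qed.

Lemma angular_measure_lty A : measurable A -> (angular_measure A < +oo)%E.
Proof.
move=> mA; apply: le_lt_trans volume_unit_ball_lty.
rewrite angular_measureE; apply: le_measure; rewrite ?inE//.
- apply: measurableI; last exact: measurable_punctured_ball.
  exact: measurable_preimage measurable_dirn mA.
- exact: measurable_unit_ball.
by move=> x [_ /andP[]].
Qed.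

Definition radial_measure : {measure set (measurableTypeR R) -> \bar R} :=
  mrestr (@lebesgue_measure R)
    (measurable_itv `]0, +oo[ : measurable (_ : set (measurableTypeR R))).

Lemma radial_measure_ray b :
  radial_measure `]-oo, b]%classic = (Num.max b 0)%:E.
Proof.
rewrite /radial_measure /= /mrestr.
rewrite (_ : _ `&` _ = `]0, b]%classic); last first.
  apply/seteqP; split => x /=; rewrite !in_itv/= andbT.
    by move=> [-> ->].
  by move=> /andP[-> ->].
rewrite lebesgue_measure_itv/= lte_fin; case: ltP => // _.
by rewrite sube0.
Qed.

Hypothesis n_gt0 : (0 < n)%N.

(** For b > 0 the sector is the sector of the unit ball scaled by the n-th root
    of [b]; hence its volume is linear in [b]. *)
Lemma volume_conical_sector (A : set (borel_rV R n)) (b : R) : measurable A ->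
  mu [set x : rV | [/\ punctured x, A (dirn x) & enorm x ^+ n <= b]] =
  ((Num.max b 0)%:E * angular_measure A)%E.
Proof.
move=> mA; have [b0|b0] := leP b 0.
  rewrite mul0e (_ : [set _ | _] = set0) ?measure0//.
  apply/seteqP; split => // x [x0 _ xb].
  by have := lt_le_trans (exprn_gt0 n x0) xb; rewrite ltNge b0.
pose c := b `^ n%:R^-1.
have c0 : 0 < c by rewrite powR_gt0.
have cn : c ^+ n = b.
  rewrite -powR_mulrn ?powR_ge0// /c -powRrM mulVf ?pnatr_eq0 -?lt0n//.
  by rewrite powRr1// ltW.
rewrite angular_measureE /borel_volume (volume_scale c0) ?cn; last first.
  rewrite (_ : [set _ | _] = punctured `&` (dirn @^-1` A `&`
     @enorm R n @^-1` ((fun t : R => t ^+ n) @^-1` `]-oo, b]%classic))).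
    apply: measurableI; first exact: measurable_punctured.
    apply: measurableI; first exact: measurable_preimage measurable_dirn mA.
    apply: (measurable_preimage (@measurable_enorm R n)).
    exact: measurable_preimage (@exprn_measurable R setT n) _.
  by apply/seteqP; split => x /=; [case|case=> ? []].
congr (_ * volume _)%E; apply/seteqP; split => x /=.
- move=> [x0 Ax xb]; rewrite /punctured/= in x0.
  have {}x0 : 0 < enorm x by move: x0; rewrite enormZ gtr0_norm// pmulr_rgt0.
  split; first by rewrite -(dirnZ x c0).
  rewrite /punctured_ball/= x0/=; move: xb.
  by rewrite enormZ gtr0_norm// exprMn cn ger_pMr// expr_le1// enorm_ge0.
- move=> [Ax /andP[x0 x1]].
  rewrite dirnZ// /punctured /= enormZ gtr0_norm//; split => //.
    exact: mulr_gt0.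
  by rewrite exprMn cn ger_pMr// expr_le1// enorm_ge0.
Qed.

(** The radius is raised to the power [n] so that the radial factor becomes
    Lebesgue measure instead of n r^(n-1) dr. *)
Definition polar_coord (x : borel_rV R n) : borel_rV R n * measurableTypeR R :=
  (dirn x, enorm x ^+ n).

Lemma measurable_polar_coord : measurable_fun setT polar_coord.
Proof.
apply: measurable_fun_pair; first exact: measurable_dirn.
exact: measurable_funX (@measurable_enorm R n).
Qed.

Definition polar_measure :
    {measure set (borel_rV R n * measurableTypeR R) -> \bar R} :=
  image_measure (mrestr mu measurable_punctured) measurable_polar_coord.

(** For fixed [A] both sides are measures in [B], which agree on rays by
    [volume_conical_sector]. *)
Lemma polar_measure_rect (A : set (borel_rV R n)) (B : set (measurableTypeR R)) :
  measurable A -> measurable B ->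
  polar_measure (A `*` B) = (angular_measure A * radial_measure B)%E.
Proof.
move=> mA; move: B.
have mA' : measurable (dirn @^-1` A `&` punctured : set (borel_rV R n)).
  apply: measurableI; last exact: measurable_punctured.
  exact: measurable_preimage measurable_dirn mA.
have mX : measurable_fun setT
    (fun x : borel_rV R n => enorm x ^+ n : measurableTypeR R).
  exact: measurable_funX (@measurable_enorm R n).
pose m1 : {measure set (measurableTypeR R) -> \bar R} :=
  image_measure (mrestr mu mA') mX.
pose m2 : {measure set (measurableTypeR R) -> \bar R} :=
  mscale (NngNum (fine_ge0 (measure_ge0 angular_measure A))) radial_measure.
have nuA : (fine (angular_measure A))%:E = angular_measure A.
  by rewrite fineK// ge0_fin_numE//; exact: angular_measure_lty.
have m1E B : m1 B = polar_measure (A `*` B).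
  rewrite /m1 /polar_measure /= /pushforward /mrestr /=.
  by congr mu; apply/seteqP; split => x /=; [case=> ? []|case=> -[]].
have m2E B : m2 B = (angular_measure A * radial_measure B)%E.
  by rewrite /m2 /= /mscale /= nuA.
have ray b : m1 `]-oo, b]%classic = ((Num.max b 0)%:E * angular_measure A)%E.
  rewrite -volume_conical_sector// /m1 /= /pushforward /mrestr /=.
  congr mu; apply/seteqP; split => x /=; rewrite in_itv/=.
    by case=> ? [].
  by case.
move=> B mB; rewrite -m1E -m2E; apply: measure_eq_rays => // b.
  by rewrite ray m2E radial_measure_ray muleC.
by rewrite ray -nuA -EFinM ltry.
Qed.

Lemma polar_measureE (E : set (borel_rV R n * measurableTypeR R)) :
  measurable E ->
  mu [set x : rV | punctured x /\ E (dirn x, enorm x ^+ n)] =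
  (\int[angular_measure]_theta
     lebesgue_measure ([set s | E (theta, s)] `&` `]0%R, +oo[%classic))%E.
Proof.
move=> mE.
have s1 : sigma_finite setT (measure_copy angular_measure).
  apply: fin_num_fun_sigma_finite; first by rewrite measure0.
  by move=> A mA; rewrite ge0_fin_numE//; exact: angular_measure_lty.
have s2 : sigma_finite setT (measure_copy radial_measure).
  exists (fun k => `]-oo, k%:R]%classic).
    apply/seteqP; split => // x _; exists (Num.truncn `|x|).+1 => //=.
    have := truncnS_gt `|x|; rewrite ltr_norml => /andP[xk kx].
    by rewrite in_itv/= ltW.
  move=> k; split; first exact: measurable_itv.
  by rewrite /measure_copy radial_measure_ray ltry.
transitivity (polar_measure E).
  rewrite /polar_measure /= /pushforward /mrestr.
  by congr mu; apply/seteqP; split => x /=; case.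
rewrite -(@product_measure_unique _ _ _ _ _
  (@sigma_finite_measure_of _ _ _ angular_measure s1)
  (@sigma_finite_measure_of _ _ _ radial_measure s2) polar_measure)//; last first.
  exact: polar_measure_rect.
apply: eq_integral => theta _; rewrite /= /measure_copy /= /mrestr.
congr (lebesgue_measure (_ `&` _)).
by apply/seteqP; split => s; rewrite /xsection/= inE.
Qed.

End polar.

(** * Flowers and mixed volumes as integrals over the sphere *)

Section flower_integral.
Context {R : realType} {n : nat}.
Hypothesis n_gt0 : (0 < n)%N.
Local Notation rV := 'rV[R]_n.
Local Notation mu := (@borel_volume R n).
Local Notation nu := (@angular_measure R n).

Lemma lee_expe (t : R) (h : \bar R) : 0 <= t -> (0 <= h)%E ->
  (t%:E <= h)%E = ((t ^+ n)%:E <= h ^+ n)%E.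
Proof.
move=> t0; case: h => [r| |]//; rewrite ?lee_fin => r0.
  by rewrite -EFin_expe lee_fin ler_pXn2r.
suff -> : (+oo ^+ n = +oo :> \bar R)%E by rewrite !leey.
by case: n n_gt0 => [//|k _]; rewrite expeS gt0_mulye// expe_gt0.
Qed.

Lemma lebesgue_measure_below (h : \bar R) : (0 <= h)%E ->
  lebesgue_measure ([set s : R | (s%:E <= h)%E] `&` `]0%R, +oo[%classic) = h.
Proof.
case: h => [r| |]//; rewrite ?lee_fin => r0.
  rewrite (_ : _ `&` _ = `]0, r]%classic); last first.
    apply/seteqP; split => s /=; rewrite !in_itv/= andbT lee_fin.
      by move=> [-> ->].
    by move=> /andP[].
  rewrite lebesgue_measure_itv/= lte_fin; case: ltP => // [_|r0'].
    by rewrite sube0.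
  by congr _%:E; apply/eqP; rewrite eq_le r0 r0'.
rewrite (_ : _ `&` _ = `]0, +oo[%classic); last first.
  by apply/seteqP; split => s /=; [case|move=> s0; split => //; rewrite leey].
by rewrite lebesgue_measure_itv/= ltry.
Qed.

Lemma set1_0_box : [set 0] = box n (0 : R).
Proof.
apply/seteqP; split => x /=; first by move=> -> i; rewrite mxE normr0.
by move=> x0; apply/rowP => i; rewrite mxE; apply/eqP; rewrite -normr_le0.
Qed.

Lemma volume_set1_0 : mu [set 0] = 0%E.
Proof.
by rewrite set1_0_box /borel_volume volume_box// mulr0 expr0n gtn_eqF.
Qed.

Lemma measurable_set1_0 : measurable ([set 0] : set (borel_rV R n)).
Proof. by rewrite set1_0_box; exact: measurable_box. Qed.

Lemma volume_flower (K : set rV) : K 0 ->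
  volume (flower K) =
  (\int[nu]_(theta in (unit_sphere : set (borel_rV R n)))
     support_fun K theta ^+ n)%E.
Proof.
move=> K0; rewrite flowerE//.
pose E : set (borel_rV R n * measurableTypeR R) :=
  [set p | unit_sphere p.1 /\ (p.2%:E <= support_fun K p.1 ^+ n)%E].
have mE : measurable E.
  rewrite (_ : E = (fst @^-1` (unit_sphere : set (borel_rV R n))) `&`
    [set p : borel_rV R n * measurableTypeR R |
      (p.2%:E <= support_fun K p.1 ^+ n)%E])//.
  apply: measurable_lee.
  - exact: measurable_preimage measurable_fst (@measurable_unit_sphere R n).
  - by apply: measurable_funTS; apply/measurable_EFinP; exact: measurable_snd.
  - apply: measurable_funTS.
    exact: (measurableT_comp
      (measurable_fun_expe n (measurable_support_fun K)) measurable_fst).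
have -> : flower_set K = [set 0] `|`
    [set x | punctured x /\ E (dirn x, enorm x ^+ n)].
  apply/seteqP; split => x.
    have [x0|/punctured_eq0 ->] := pselect (punctured x); last by left.
    move=> Kx; right; split => //; split; first exact: dirn_sphere.
    rewrite /= -lee_expe ?enorm_ge0 ?support_fun_ge0//.
    by apply/(flower_setZ K0 (dirn_sphere x0) (enorm_ge0 x)); rewrite dirnK.
  move=> [->|[x0 [sx /=]]].
    have [th th1] := @unit_sphere_nonempty R n n_gt0.
    have [_] := flower_setZ K0 th1 (lexx 0).
    by rewrite scale0r; apply; exact: support_fun_ge0.
  rewrite -lee_expe ?enorm_ge0 ?support_fun_ge0// => xh.
  rewrite -(dirnK x0).
  by apply/(flower_setZ K0 (dirn_sphere x0) (enorm_ge0 x)).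
rewrite -[LHS]/(mu _) measureU; last 3 first.
- exact: measurable_set1_0.
- rewrite (_ : [set x | _] = punctured `&` polar_coord @^-1` E)//.
  apply: measurableI; first exact: measurable_punctured.
  exact: measurable_preimage measurable_polar_coord mE.
- apply/seteqP; split => // x /= [-> [+ _]].
  by rewrite /punctured/= enorm0 ltxx.
rewrite [X in (X + _)%E]volume_set1_0 add0e [LHS](polar_measureE n_gt0 mE).
rewrite [RHS]integral_mkcond.
apply: eq_integral => theta _; rewrite patchE.
case: ifPn => [/set_mem th|/negP th].
  rewrite -[RHS]lebesgue_measure_below ?expe_ge0 ?support_fun_ge0//.
  by congr (lebesgue_measure (_ `&` _)); apply/seteqP; split => s //= [].
rewrite (_ : _ `&` _ = set0) ?measure0//.
by apply/seteqP; split => // s [[sth _] _]; apply: th; rewrite inE.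
Qed.

Lemma volume_cone (A : set (borel_rV R n)) :
  measurable A -> volume (cone A) = nu A.
Proof.
move=> mA; rewrite angular_measureE.
(* the apex belongs to the cone exactly when the base is non-empty *)
have coneE : cone A = (dirn @^-1` A `&` punctured_ball) `|`
    ([set 0] `&` [set _ | A `&` unit_sphere !=set0]).
  apply/seteqP; split => x.
    move=> [t /= /andP[t0 t1] [th [Ath sth] <-]].
    have [->|tn0] := eqVneq t 0.
      by right; rewrite scale0r; split => //; exists th.
    have {t0 tn0} t0 : 0 < t by rewrite lt_neqAle eq_sym tn0.
    have e : enorm (t *: th) = t by rewrite enormZ gtr0_norm// sth mulr1.
    left; split; last by rewrite /punctured_ball/= e t0.
    by rewrite /= dirnZ// /dirn sth invr1 scale1r.
  move=> [[Ax /andP[x0 x1]]|[-> [th [Ath sth]]]].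
    exists (enorm x); first by rewrite /= x1 ltW.
    exists (dirn x); last exact: dirnK.
    by split => //; exact: dirn_sphere.
  by exists 0 => //; [rewrite /= lexx ler01|exists th => //; rewrite scale0r].
have mY : measurable (dirn @^-1` A `&` punctured_ball : set (borel_rV R n)).
  apply: measurableI; last exact: measurable_punctured_ball.
  exact: measurable_preimage measurable_dirn mA.
rewrite coneE -[LHS]/(mu _).
have [ne|ne] := pselect (A `&` unit_sphere !=set0).
  rewrite (_ : [set 0] `&` _ = [set 0]); last first.
    by apply/seteqP; split => x //= [].
  rewrite measureU//; [|exact: measurable_set1_0|].
    by rewrite [X in (_ + X)%E]volume_set1_0 adde0.
  apply/seteqP; split => // x [[_ /andP[x0 _]] /= xE]; move: x0.
  by rewrite xE enorm0 ltxx.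
rewrite (_ : [set 0] `&` _ = set0) ?setU0//.
by apply/seteqP; split => // x [_] /=.
Qed.

(** The spherical measure is [nu] divided by the volume of the ball, which is
    positive and finite, so the two normalizing factors cancel. *)
Lemma flower_mixed_volumeE (K : 'I_n -> set rV) : (forall j, K j 0) ->
  flower_mixed_volume K =
  (\int[nu]_(theta in (unit_sphere : set (borel_rV R n)))
     \big[*%E/1%E]_(j < n) support_fun (K j) theta)%E.
Proof.
move=> K0; rewrite /flower_mixed_volume.
have B0 : (mu unit_ball != 0)%E by rewrite gt_eqF// volume_unit_ball_gt0.
have Bfin : mu unit_ball \is a fin_num.
  by rewrite ge0_fin_numE//; exact: volume_unit_ball_lty.
have Br : ((fine (mu unit_ball))^-1)%:E = (mu unit_ball)^-1%E.
  rewrite -[in RHS](fineK Bfin) inver ifF//.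
  by apply: contra_neqF B0 => /eqP e; rewrite -(fineK Bfin) e.
have r0 : 0 <= (fine (mu unit_ball))^-1 by rewrite invr_ge0 fine_ge0.
have mprod : measurable_fun setT (fun theta : borel_rV R n =>
    \big[*%E/1%E]_(j < n) support_fun (K j) theta).
  by apply: emeasurable_prod => j; exact: measurable_support_fun.
have prod0 theta : (0 <= \big[*%E/1%E]_(j < n) support_fun (K j) theta)%E.
  by apply: prode_ge0 => j _; exact: support_fun_ge0.
pose m : {measure set (borel_rV R n) -> \bar R} := mscale (NngNum r0) nu.
rewrite (@integral_agree _ _ _ _ m); last first.
  move=> A mA; rewrite /sphere_measure volume_cone// muleC.
  by rewrite /m /= /mscale /= -Br.
rewrite (@ge0_integral_mscale _ _ _ nu _ (@measurable_unit_sphere R n)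
  (NngNum r0))//; last exact: measurable_funTS.
by rewrite muleA /= Br divee// mul1e.
Qed.

End flower_integral.

(** * Support functions of Minkowski combinations *)

Section support_function.
Context {R : realType} {n : nat}.
Local Notation rV := 'rV[R]_n.
Implicit Types (A B K : set rV) (theta x : rV).

Lemma dotpC x theta : dotp x theta = dotp theta x.
Proof. by apply: eq_bigr => i _; rewrite mulrC. Qed.

Lemma dotpDl x y theta : dotp (x + y) theta = dotp x theta + dotp y theta.
Proof. by rewrite -big_split; apply: eq_bigr => i _; rewrite mxE mulrDl. Qed.

Lemma dotpZl (l : R) x theta : dotp (l *: x) theta = l * dotp x theta.
Proof. by rewrite -[theta in LHS]scale1r dotpZ mulr1. Qed.

Lemma dotp0l theta : dotp 0 theta = 0.
Proof. by rewrite -(scale0r (0 : rV)) dotpZl mul0r. Qed.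

Lemma le_support_fun K theta x :
  K x -> ((dotp x theta)%:E <= support_fun K theta)%E.
Proof. by move=> Kx; apply: ereal_sup_ubound; exists x. Qed.

Lemma support_fun_closure A theta :
  support_fun (closure A) theta = support_fun A theta.
Proof.
apply/eqP; rewrite eq_le; apply/andP; split; last first.
  by apply: ereal_sup_le => _ [x Ax <-]; exists x => //; exact: subset_closure.
apply: ge_ereal_sup => _ [x clAx <-]; rewrite leNgt; apply/negP => hx.
have [y [Ay yP]] : A `&`
    [set y | (support_fun A theta < (dotp y theta)%:E)%E] !=set0.
  apply: clAx; apply: open_nbhs_nbhs; split=> //.
  case: (support_fun A theta) hx => [r| |] // hx; last first.
    rewrite (_ : [set _ | _] = setT); first exact: openT.
    by apply/seteqP; split => // y _; exact: ltNyr.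
  rewrite (_ : [set _ | _] = dotp theta @^-1` `]r, +oo[%classic); last first.
    by apply/seteqP; split => y /=; rewrite in_itv/= andbT lte_fin dotpC.
  apply: open_comp; last exact: rray_open.
  by move=> y _; exact: dotp_continuous.
by have := lt_le_trans yP (le_support_fun theta Ay); rewrite ltxx.
Qed.

Lemma support_fun_add A B theta : A 0 -> B 0 ->
  support_fun (minkowski_add A B) theta =
  (support_fun A theta + support_fun B theta)%E.
Proof.
move=> A0 B0; rewrite /minkowski_add support_fun_closure.
apply/eqP; rewrite eq_le; apply/andP; split.
  apply: ge_ereal_sup => _ [_ [x Ax [y By <-]] <-].
  by rewrite dotpDl EFinD leeD// le_support_fun.
set S := [set x + y | x in A & y in B].
have hS x y : A x -> B y ->
    ((dotp x theta)%:E + (dotp y theta)%:E <= support_fun S theta)%E.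
  move=> Ax By; rewrite -EFinD -dotpDl; apply: le_support_fun.
  by exists x => //; exists y.
have S0 : (0 <= support_fun S theta)%E.
  by apply: support_fun_ge0; exists 0 => //; exists 0 => //; rewrite addr0.
(* once the left-hand side is finite the two suprema can be split off in turn *)
have [->|Soo] := eqVneq (support_fun S theta) +oo%E; first by rewrite leey.
have BS : (support_fun B theta <= support_fun S theta)%E.
  apply: ge_ereal_sup => _ [y By <-].
  by have := hS 0 y A0 By; rewrite dotp0l add0e.
have Bfin : support_fun B theta \is a fin_num.
  rewrite ge0_fin_numE ?support_fun_ge0//; apply: le_lt_trans BS _.
  by rewrite ltey.
rewrite -leeBrDr//; apply: ge_ereal_sup => _ [x Ax <-].
rewrite leeBrDr// addeC -leeBrDr//; apply: ge_ereal_sup => _ [y By <-].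
by rewrite leeBrDr// addeC; exact: hS.
Qed.

Lemma support_fun_set1_0 theta : support_fun [set 0] theta = 0%E.
Proof. by rewrite /support_fun image_set1 ereal_sup1 dotp0l. Qed.

Lemma support_fun_dilate (l : R) K theta : 0 <= l -> K 0 ->
  support_fun (dilate l K) theta = (l%:E * support_fun K theta)%E.
Proof.
move=> l0 K0; rewrite /support_fun -ereal_supZl//; last first.
  by apply/set0P; exists (dotp 0 theta)%:E, 0.
congr ereal_sup; apply/seteqP; split => _ [_ [x Kx <-] <-].
  by exists (dotp x theta)%:E; [exists x|rewrite dotpZl].
exists (l *: x); first by exists x.
by rewrite dotpZl EFinM.
Qed.

Lemma support_fun_comb m (lam : 'I_m -> R) (K : 'I_m -> set rV) theta :
  (forall i, 0 <= lam i) -> (forall i, K i 0) ->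
  minkowski_comb lam K 0 /\ support_fun (minkowski_comb lam K) theta =
    (\sum_(i < m) (lam i)%:E * support_fun (K i) theta)%E.
Proof.
move=> lam0 K0; rewrite /minkowski_comb.
apply: (big_rec2 (fun (A : set rV) v => A 0 /\ support_fun A theta = v)).
  by split => //; exact: support_fun_set1_0.
move=> i v A _ [A0 <-].
have D0 : dilate (lam i) (K i) 0 by exists 0 => //; rewrite scaler0.
split; last by rewrite support_fun_add// support_fun_dilate.
by apply: subset_closure; exists 0 => //; exists 0 => //; rewrite addr0.
Qed.

End support_function.

(** * Distributivity in [0, +oo] *)

Section nonneg_ereal.
Context {R : realType}.
Local Open Scope ereal_scope.

(** Multiplication distributes over addition only for non-negative extended
    reals, so the operators are bundled on this subtype before the
    general distributivity law of iterated operators is applied. *)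
Definition nnereal := {x : \bar R | 0 <= x}.

Definition nn0 : nnereal := exist _ 0 (lexx 0).
Definition nn1 : nnereal := exist _ 1 lee01.
Definition nnadd (x y : nnereal) : nnereal :=
  exist _ (val x + val y) (adde_ge0 (valP x) (valP y)).
Definition nnmul (x y : nnereal) : nnereal :=
  exist _ (val x * val y) (mule_ge0 (valP x) (valP y)).

Let nnaddA : associative nnadd.
Proof. by move=> x y z; apply: val_inj; rewrite /= addeA. Qed.
Let nnaddC : commutative nnadd.
Proof. by move=> x y; apply: val_inj; rewrite /= addeC. Qed.
Let nnadd0 : left_id nn0 nnadd.
Proof. by move=> x; apply: val_inj; rewrite /= add0e. Qed.
Let nnmul0 : left_zero nn0 nnmul.
Proof. by move=> x; apply: val_inj; rewrite /= mul0e. Qed.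
Let nnmul0r : right_zero nn0 nnmul.
Proof. by move=> x; apply: val_inj; rewrite /= mule0. Qed.
Let nnmulDl : left_distributive nnmul nnadd.
Proof. by move=> x y z; apply: val_inj; rewrite /= ge0_muleDl//; exact: valP. Qed.
Let nnmulDr : right_distributive nnmul nnadd.
Proof. by move=> x y z; apply: val_inj; rewrite /= ge0_muleDr//; exact: valP. Qed.

HB.instance Definition _ :=
  Monoid.isMulLaw.Build nnereal nn0 nnmul nnmul0 nnmul0r.
HB.instance Definition _ :=
  Monoid.isComLaw.Build nnereal nn0 nnadd nnaddA nnaddC nnadd0.
HB.instance Definition _ :=
  Monoid.isAddLaw.Build nnereal nnmul nnadd nnmulDl nnmulDr.

Lemma prode_sum_distr (I J : finType) (F : I -> J -> \bar R) :
  (forall i j, 0 <= F i j) ->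
  \big[*%E/1]_i \sum_j F i j =
  \sum_(f : {ffun I -> J}) \big[*%E/1]_i F i (f i).
Proof.
move=> F0; pose G i j : nnereal := exist _ (F i j) (F0 i j).
have addM : {morph (val : nnereal -> \bar R) : x y / nnadd x y >-> x + y} by [].
have mulM : {morph (val : nnereal -> \bar R) : x y / nnmul x y >-> x * y} by [].
have := congr1 val (@bigA_distr_bigA _ nn0 nn1 nnmul nnadd I J G).
rewrite (big_morph _ mulM (erefl (val nn1))) (big_morph _ addM (erefl (val nn0))).
under eq_bigr do rewrite (big_morph _ addM (erefl (val nn0))).
move=> ->; apply: eq_bigr => f _.
by rewrite (big_morph _ mulM (erefl (val nn1))).
Qed.

End nonneg_ereal.

(** * A weighted Cauchy-Schwarz inequality in [0, +oo] *)

Lemma weighted_young (R : realType) (t : R) (a b c : \bar R) : 0 < t ->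
  (0 <= a -> 0 <= b -> 0 <= c ->
  2%:E * (a * (b * c)) <= t%:E * (a * (a * c)) + t^-1%:E * (b * (b * c)))%E.
Proof.
move=> t0 a0 b0 c0.
have t'0 : 0 < t^-1 by rewrite invr_gt0.
have [->|an0] := eqVneq a 0%E.
  by rewrite !mul0e !mule0 add0e !mule_ge0// lee_fin ltW.
have [->|bn0] := eqVneq b 0%E.
  by rewrite !mul0e !mule0 adde0 !mule_ge0// lee_fin ltW.
have [->|cn0] := eqVneq c 0%E; first by rewrite !mule0 adde0.
have {an0}a0 : (0 < a)%E by rewrite lt0e an0.
have {bn0}b0 : (0 < b)%E by rewrite lt0e bn0.
have {cn0}c0 : (0 < c)%E by rewrite lt0e cn0.
have tE : (0 < t%:E)%E by rewrite lte_fin.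
have t'E : (0 < t^-1%:E)%E by rewrite lte_fin.
(* with all three positive, an infinite one makes the right-hand side infinite *)
case: c c0 => [c c0|_|//]; last by rewrite !gt0_muley// ?mule_gt0// leey.
case: a a0 => [a a0|_|//]; last first.
  rewrite [(+oo * c%:E)%E]gt0_mulye// !gt0_muley// addye ?leey//.
  by rewrite gt_eqF// (lt_le_trans ltNy0)// !mule_ge0 ?ltW.
case: b b0 => [b b0|_|//]; last first.
  rewrite [X in (_ <= _ + X)%E](_ : _ = +oo%E) ?addey ?leey//.
  by rewrite (gt0_mulye c0) gt0_muley ?gt0_muley.
rewrite !lte_fin in a0 b0 c0.
rewrite -!EFinM -EFinD lee_fin.
have -> : t * (a * (a * c)) + t^-1 * (b * (b * c)) =
    2 * (a * (b * c)) + t^-1 * (t * a - b) ^+ 2 * c.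
  by field; rewrite gt_eqF.
rewrite lerDl; apply: mulr_ge0; last exact: ltW.
by apply: mulr_ge0; [exact: ltW|exact: sqr_ge0].
Qed.

Section cauchy_schwarz.
Local Open Scope ereal_scope.
Context d (T : measurableType d) (R : realType).
Variables (m : {measure set T -> \bar R}) (D : set T).
Hypothesis mD : measurable D.

(** Compare [h] with [+oo * k], whose integral is [+oo * 0 = 0]. *)
Lemma ge0_integral_eq0 (h k : T -> \bar R) :
  measurable_fun D h -> measurable_fun D k ->
  (forall x, D x -> 0 <= h x) -> (forall x, D x -> 0 <= k x) ->
  (forall x, D x -> k x = 0 -> h x = 0) ->
  \int[m]_(x in D) k x = 0 -> \int[m]_(x in D) h x = 0.
Proof.
move=> mh mk h0 k0 kh ik0.
apply/eqP; rewrite eq_le integral_ge0// andbT.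
apply: (@le_trans _ _ (\int[m]_(x in D) (+oo * k x))); last first.
  by rewrite ge0_integralZl// ik0 mule0.
apply: ge0_le_integral => //; first exact: measurable_funeM.
move=> x Dx; have [kx|kx] := eqVneq (k x) 0; first by rewrite kh// kx mule0.
by rewrite gt0_mulye ?leey// lt0e kx k0.
Qed.

Variables f g p : T -> \bar R.
Hypotheses (mf : measurable_fun D f) (mg : measurable_fun D g)
  (mp : measurable_fun D p).
Hypotheses (f0 : forall x, D x -> 0 <= f x) (g0 : forall x, D x -> 0 <= g x)
  (p0 : forall x, D x -> 0 <= p x).

(** Integrate [weighted_young] and choose the best parameter. The convention
    0 * oo = 0 makes the case of a vanishing factor on the right delicate: it is
    settled by [ge0_integral_eq0], since the left integrand vanishes wherever
    either integrand on the right does. *)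
Lemma weighted_cauchy_schwarz :
  (\int[m]_(x in D) (f x * (g x * p x))) ^+ 2 <=
  (\int[m]_(x in D) (f x * (f x * p x))) *
  \int[m]_(x in D) (g x * (g x * p x)).
Proof.
have mM (u v : T -> \bar R) : measurable_fun D u -> measurable_fun D v ->
  measurable_fun D (fun x => u x * v x) by exact: emeasurable_funM.
have mfgp := mM _ _ mf (mM _ _ mg mp).
have mffp := mM _ _ mf (mM _ _ mf mp).
have mggp := mM _ _ mg (mM _ _ mg mp).
have fgp0 x : D x -> 0 <= f x * (g x * p x).
  by move=> Dx; rewrite !mule_ge0 ?f0 ?g0 ?p0.
have ffp0 x : D x -> 0 <= f x * (f x * p x).
  by move=> Dx; rewrite !mule_ge0 ?f0 ?g0 ?p0.
have ggp0 x : D x -> 0 <= g x * (g x * p x).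
  by move=> Dx; rewrite !mule_ge0 ?f0 ?g0 ?p0.
have A0 : 0 <= \int[m]_(x in D) (f x * (f x * p x)) by exact: integral_ge0.
have B0 : 0 <= \int[m]_(x in D) (g x * (g x * p x)) by exact: integral_ge0.
have C0 : 0 <= \int[m]_(x in D) (f x * (g x * p x)) by exact: integral_ge0.
have young (t : R) : (0 < t)%R ->
    2%:E * (\int[m]_(x in D) (f x * (g x * p x))) <=
    t%:E * (\int[m]_(x in D) (f x * (f x * p x))) +
    t^-1%:E * \int[m]_(x in D) (g x * (g x * p x)).
  move=> t0; have t'0 : (0 <= t^-1)%R by rewrite invr_ge0 ltW.
  have tffp0 x : D x -> 0 <= t%:E * (f x * (f x * p x)).
    by move=> Dx; rewrite mule_ge0 ?ffp0// lee_fin ltW.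
  have tggp0 x : D x -> 0 <= t^-1%:E * (g x * (g x * p x)).
    by move=> Dx; rewrite mule_ge0 ?ggp0// lee_fin.
  rewrite -(ge0_integralZl_EFin m mD fgp0 mfgp (ler0n R 2)).
  rewrite -(ge0_integralZl_EFin m mD ffp0 mffp (ltW t0)).
  rewrite -(ge0_integralZl_EFin m mD ggp0 mggp t'0).
  rewrite -(ge0_integralD m mD tffp0 (measurable_funeM _ mffp)
    tggp0 (measurable_funeM _ mggp)).
  apply: ge0_le_integral => //.
  - by move=> x Dx; rewrite mule_ge0 ?fgp0.
  - exact: measurable_funeM.
  - by apply: emeasurable_funD; exact: measurable_funeM.
  - move=> x Dx.
    by apply: weighted_young => //; [exact: f0|exact: g0|exact: p0].
have A_eq0 : \int[m]_(x in D) (f x * (f x * p x)) = 0 ->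
    \int[m]_(x in D) (f x * (g x * p x)) = 0.
  apply: ge0_integral_eq0 => // x Dx /eqP; rewrite !mule_eq0 orbA orbb.
  by move=> /orP[/eqP->|/eqP->]; rewrite ?mul0e// !mule0.
have B_eq0 : \int[m]_(x in D) (g x * (g x * p x)) = 0 ->
    \int[m]_(x in D) (f x * (g x * p x)) = 0.
  apply: ge0_integral_eq0 => // x Dx /eqP; rewrite !mule_eq0 orbA orbb.
  by move=> /orP[/eqP->|/eqP->]; rewrite ?mul0e// !mule0.
move: A0 B0 C0 young A_eq0 B_eq0.
set A := \int[m]_(x in D) (f x * (f x * p x)).
set B := \int[m]_(x in D) (g x * (g x * p x)).
set C := \int[m]_(x in D) (f x * (g x * p x)).
move=> A0 B0 C0 young A_eq0 B_eq0.
have [->|Cn0] := eqVneq C 0; first by rewrite expe2 mul0e mule_ge0.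
have {}A0 : 0 < A by rewrite lt0e A0 andbT; apply: contra_neq Cn0.
have {}B0 : 0 < B by rewrite lt0e B0 andbT; apply: contra_neq Cn0.
have {Cn0}C0 : 0 < C by rewrite lt0e Cn0.
case: A A0 young {A_eq0} => [a a0 young|_ _|//]; last by rewrite gt0_mulye// leey.
case: B B0 young {B_eq0} => [b b0 young|_ _|//]; last by rewrite gt0_muley// leey.
case: C C0 young => [c c0 young| _ |//]; last first.
  by move=> /(_ 1%R ltr01); rewrite invr1 !mul1e -EFinD gt0_muley// leye_eq.
rewrite !lte_fin in a0 b0 c0.
(* t = c/a turns 2c <= ta + b/t into 2c <= c + ab/c *)
have := young (c / a)%R (divr_gt0 c0 a0).
rewrite expe2 -!EFinM -EFinD !lee_fin divfK ?gt_eqF// invf_div => h.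
have : (c <= a * b / c)%R by lra.
by rewrite ler_pdivlMr.
Qed.

End cauchy_schwarz.

(** * Polynomiality and the quadratic inequality *)

Lemma volume_flower_minkowski_comb (R : realType) n (n_gt0 : (0 < n)%N) m
    (K : 'I_m -> set 'rV[R]_n) (lam : 'I_m -> R) :
  (forall i, K i 0) -> (forall i, 0 <= lam i) ->
  volume (flower (minkowski_comb lam K)) =
  (\sum_(i : {ffun 'I_n -> 'I_m})
     flower_mixed_volume (fun j => K (i j)) * (\prod_(j < n) lam (i j))%R%:E)%E.
Proof.
move=> K0 lam0.
have [comb0 _] := support_fun_comb 0 lam0 K0.
rewrite volume_flower//.
have mprod (i : {ffun 'I_n -> 'I_m}) : measurable_fun
    (unit_sphere : set (borel_rV R n))
    (fun theta => \big[*%E/1%E]_(j < n) support_fun (K (i j)) theta).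
  apply: measurable_funTS; apply: emeasurable_prod => j.
  exact: measurable_support_fun.
have prod0 (i : {ffun 'I_n -> 'I_m}) theta :
    (0 <= \big[*%E/1%E]_(j < n) support_fun (K (i j)) theta)%E.
  by apply: prode_ge0 => j _; exact: support_fun_ge0.
have lamprod0 (i : {ffun 'I_n -> 'I_m}) : 0 <= \prod_(j < n) lam (i j).
  exact: prodr_ge0.
under eq_integral => theta _.
  rewrite (support_fun_comb theta lam0 K0).2 -prode_const.
  rewrite (prode_sum_distr
    (F := fun=> fun i => ((lam i)%:E * support_fun (K i) theta)%E)); last first.
    by move=> _ i; rewrite mule_ge0 ?lee_fin ?support_fun_ge0.
  under eq_bigr do rewrite big_split/= prodEFin.
  over.
rewrite ge0_integral_sum//; last 3 first.
- exact: measurable_unit_sphere.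
- by move=> i; exact: measurable_funeM.
- by move=> i theta _; rewrite mule_ge0// lee_fin.
apply: eq_bigr => i _.
rewrite ge0_integralZl_EFin//; last exact: measurable_unit_sphere.
by rewrite flower_mixed_volumeE// muleC.
Qed.

Lemma flower_mixed_volume_sqr (R : realType) n (n_gt0 : (0 < n)%N)
    (n_gt1 : (1 < n)%N) (K : 'I_n -> set 'rV[R]_n)
    (K1 := K (Ordinal n_gt0)) (K2 := K (Ordinal n_gt1)) :
  (forall j, K j 0) ->
  (flower_mixed_volume K ^+ 2 <=
   flower_mixed_volume (fun j => if (j < 2)%N then K1 else K j) *
   flower_mixed_volume (fun j => if (j < 2)%N then K2 else K j))%E.
Proof.
move=> K0; rewrite !flower_mixed_volumeE//; last 2 first.
- by move=> j; case: ifP => _; exact: K0.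
- by move=> j; case: ifP => _; exact: K0.
have split2 (L : 'I_n -> set 'rV[R]_n) theta :
    (\big[*%E/1%E]_(j < n) support_fun (L j) theta =
     support_fun (L (Ordinal n_gt0)) theta *
     (support_fun (L (Ordinal n_gt1)) theta *
      \big[*%E/1%E]_(j < n | (1 < j)%N) support_fun (L j) theta))%E.
  rewrite (bigD1 (Ordinal n_gt0))//= (bigD1 (Ordinal n_gt1))//=.
  congr (_ * (_ * _))%E; apply: eq_bigl => j; rewrite -!val_eqE /=.
  by case: (nat_of_ord j) => [|[|k]].
pose p theta :=
  (\big[*%E/1%E]_(j < n | (1 < j)%N) support_fun (K j) theta)%E.
have pE (L : set 'rV[R]_n) theta :
    (\big[*%E/1%E]_(j < n | (1 < j)%N)
       support_fun (if (j < 2)%N then L else K j) theta)%E = p theta.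
  by apply: eq_bigr => j j1; rewrite ltnNge j1.
under eq_integral do rewrite split2.
under [X in (_ <= X * _)%E]eq_integral do rewrite split2 pE.
under [X in (_ <= _ * X)%E]eq_integral do rewrite split2 pE.
have mh (L : set 'rV[R]_n) : measurable_fun
    (unit_sphere : set (borel_rV R n)) (support_fun L).
  by apply: measurable_funTS; exact: measurable_support_fun.
apply: weighted_cauchy_schwarz => //.
- exact: measurable_unit_sphere.
- apply: measurable_funTS; rewrite /p; under eq_fun do rewrite -big_filter.
  by apply: emeasurable_prod => j; exact: measurable_support_fun.
- by move=> theta _; exact: support_fun_ge0.
- by move=> theta _; exact: support_fun_ge0.
- by move=> theta _; apply: prode_ge0 => j _; exact: support_fun_ge0.
Qed.

Theorem theorem16 (R : realType) (n : nat) (n_gt0 : (0 < n)%N) :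
  (forall (m : nat) (K : 'I_m -> set 'rV[R]_n),
      (0 < m)%N -> (forall i, convex_body (K i)) ->
    forall lam : 'I_m -> R, (forall i, 0 <= lam i) ->
      volume (flower (minkowski_comb lam K)) =
      (\sum_(i : {ffun 'I_n -> 'I_m})
         flower_mixed_volume (fun j => K (i j)) *
         (\prod_(j < n) lam (i j))%R%:E)%E)
  /\
  (forall (n_gt1 : (1 < n)%N) (K : 'I_n -> set 'rV[R]_n),
      (forall j, convex_body (K j)) ->
    let K1 := K (Ordinal n_gt0) in
    let K2 := K (Ordinal n_gt1) in
    (flower_mixed_volume K ^+ 2 <=
      flower_mixed_volume (fun j => if (j < 2)%N then K1 else K j) *
      flower_mixed_volume (fun j => if (j < 2)%N then K2 else K j))%E).
Proof.
split.
  move=> m K _ cK lam lam0.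
  by apply: volume_flower_minkowski_comb => // i; have [] := cK i.
by move=> n_gt1 K cK; apply: flower_mixed_volume_sqr => j; have [] := cK j.
Qed.
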